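(* Let $m\geq1$, $N=2^m-1$, $\rho=1+\sqrt2$, and $\lambda>0$. Let $(h_0,\ldots,h_{N-1})$ be the original silver schedule of length $N$. Let $F:\mathbb{R}^d\to\mathbb{R}\cup\{+\infty\}$ be proper, closed and convex with a minimizer, let $x_0\in\mathbb{R}^d$, and run relaxed proximal point $$z_k=\operatorname{prox}_{\lambda F}(x_k),\qquad x_{k+1}=x_k+h_k(z_k-x_k),\qquad k=0,\ldots,N-1,$$ with $z_N=\operatorname{prox}_{\lambda F}(x_N)$. Then for every $x_*\in\arg\min F$, $$F(z_N)-F_*\leq\frac{\|x_0-x_*\|^2}{4\lambda\rho^m},$$ where $F_*=\min F$.
   Context: Norms are Euclidean, and $\operatorname{prox}_{\lambda F}(x)=\arg\min_z\{F(z)+\frac{1}{2\lambda}\|z-x\|^2\}$. The original silver schedule of length $N=2^m-1$ is $h_k=1+\rho^{\nu(k+1)-1}$ for $k=0,\ldots,N-1$, where $\rho=1+\sqrt2$ and $\nu(j)$ is the largest integer $e$ such that $2^e$ divides $j$. Equivalently, the schedule for $m=1$ is $(\sqrt2)$, and the schedule for $m+1$ is the schedule for $m$, followed by the single step $1+\rho^{m-1}$, followed by the schedule for $m$ again. Its total length satisfies $1+\sum_{k=0}^{N-1}h_k=\rho^m$. *)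

(* Defs.v *)
From HB Require Import structures.
From mathcomp Require Import all_boot all_order all_algebra.
From mathcomp Require Import all_classical all_reals all_analysis.
Set Implicit Arguments.
Unset Strict Implicit.
Unset Printing Implicit Defensive.
Import Order.TTheory GRing.Theory Num.Theory.
Import numFieldNormedType.Exports.
Local Open Scope classical_set_scope.
Local Open Scope ring_scope.

(* The library norm `|x| on 'rV[R]_d is the sup norm; it induces the same
   topology as the Euclidean norm below. *)
Definition enorm (R : realType) (d : nat) (x : 'rV[R]_d) : R :=
  Num.sqrt (\sum_(i < d) x ord0 i ^+ 2).

Definition argmin (T : Type) (R : realType) (f : T -> \bar R) : set T :=
  [set x | forall y, (f x <= f y)%E].

Definition proper_fun (T : Type) (R : realType) (f : T -> \bar R) : Prop :=
  (forall x, f x != -oo%E) /\ (exists x, (f x < +oo)%E).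

(* Closed means closed epigraph. *)
Definition closed_fun (R : realType) (d : nat) (f : 'rV[R]_d -> \bar R) :
    Prop :=
  closed [set p : 'rV[R]_d * R | (f p.1 <= p.2%:E)%E].

(* Meant for functions that avoid -oo; the endpoints t = 0 and t = 1 are
   harmless because 0 * +oo = 0 in \bar R. *)
Definition convex_fun (R : realType) (d : nat) (f : 'rV[R]_d -> \bar R) :
    Prop :=
  forall (x y : 'rV[R]_d) (t : R), 0 <= t -> t <= 1 ->
    (f (t *: x + (1 - t) *: y)%R <= t%:E * f x + (1 - t)%:E * f y)%E.

(* [get] picks an element of the set of minimizers, which is a singleton when
   F is proper, closed and convex and 0 < lam (and returns a default point if
   that set is empty). *)
Definition prox (R : realType) (d : nat) (lam : R) (F : 'rV[R]_d -> \bar R)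
    (x : 'rV[R]_d) : 'rV[R]_d :=
  get (argmin (fun z => (F z + (1 / (2 * lam) * enorm (z - x) ^+ 2)%:E)%E)).

Definition rho (R : realType) : R := 1 + Num.sqrt 2.

(* [logn 2 k.+1] is the 2-adic valuation of k + 1; the exponent is an integer
   and equals -1 when k is even. *)
Definition silver (R : realType) (k : nat) : R :=
  1 + rho R ^ ((logn 2 k.+1)%:Z - 1).

(* Main.v *)
(* Put g_k = x_k - z_k, phi_k = lam F(z_k) and
   gap_k(w, c) = c - phi_k - <g_k, w - z_k>, which is nonnegative when
   c = lam F(w), because g_k / lam is a subgradient of F at z_k. The key
   inequality, for n = 2^m - 1, is
     rho^(2m) |g_n|^2 + 2 sum_(k<n) h_k gap_k(z_n, phi_n) <= |x_0 - z_n|^2.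
   It goes by induction on m: sum_k h_k gap_k(w, c) is affine in (w, c), with
   coefficients known from sum_k h_k = rho^m - 1 and
   sum_k h_k g_k = x_0 - x_n, so the reference point can be moved; the
   inequality for 2^(m+1) - 1 is then the first-half inequality plus 1 + 2 rho
   times the second-half one plus nonnegative multiples of gaps. Moving the
   reference point to xs and completing a square yields the rate. *)
Require Import Defs.
From HB Require Import structures.
From mathcomp Require Import all_boot all_order all_algebra.
From mathcomp Require Import ring lra zify.
From mathcomp Require Import all_classical all_reals all_analysis.
Import Order.TTheory GRing.Theory Num.Theory.
Import numFieldNormedType.Exports.
Local Open Scope classical_set_scope.
Local Open Scope ring_scope.

(** * Euclidean inner product on row vectors *)

Section Dot.
Context {R : realType} {d : nat}.
Implicit Types u v w : 'rV[R]_d.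

Definition dot u v : R := \sum_(i < d) u ord0 i * v ord0 i.

Lemma dotC u v : dot u v = dot v u.
Proof. by apply: eq_bigr => i _; rewrite mulrC. Qed.

Lemma dotDl u v w : dot (u + v) w = dot u w + dot v w.
Proof. by rewrite -big_split; apply: eq_bigr => i _; rewrite mxE mulrDl. Qed.

Lemma dotZl a u v : dot (a *: u) v = a * dot u v.
Proof. by rewrite /dot mulr_sumr; apply: eq_bigr => i _; rewrite mxE mulrA. Qed.

Lemma dotNl u v : dot (- u) v = - dot u v.
Proof. by rewrite -scaleN1r dotZl mulN1r. Qed.

Lemma dotDr u v w : dot u (v + w) = dot u v + dot u w.
Proof. by rewrite dotC dotDl !(dotC u). Qed.

Lemma dotZr a u v : dot u (a *: v) = a * dot u v.
Proof. by rewrite dotC dotZl dotC. Qed.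

Lemma dotNr u v : dot u (- v) = - dot u v.
Proof. by rewrite dotC dotNl dotC. Qed.

Definition dotE := (dotDl, dotDr, dotNl, dotNr, dotZl, dotZr).

Lemma dot_suml n (f : 'I_n -> 'rV[R]_d) u :
  dot (\sum_i f i) u = \sum_i dot (f i) u.
Proof.
elim/big_rec2: _ => [|i y1 y2 _ <-]; last by rewrite dotDl.
by rewrite -(scale0r 0) dotZl mul0r.
Qed.

Lemma dot_ge0 u : 0 <= dot u u.
Proof. by apply: sumr_ge0 => i _; rewrite -expr2 sqr_ge0. Qed.

Lemma sqr_enorm u : enorm u ^+ 2 = dot u u.
Proof.
rewrite /enorm sqr_sqrtr; last by apply: sumr_ge0 => i _; exact: sqr_ge0.
by apply: eq_bigr => i _; rewrite expr2.
Qed.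

End Dot.

(** * Algebraic certificate joining two half runs *)

Section Certificate.
Context {R : realType} {d : nat}.

(* [A] and [B] stand for the gap sums of the two half runs x0, .., xn and
   y, .., xN, measured at their own last points zn and zN; the fourth inequality
   is nonnegativity of the second gap sum measured at zn instead. *)
Lemma descent_glue (r t A B f g : R) (x0 xn zn xN zN : 'rV[R]_d)
    (h := 1 + t * (r - 2)) (y := xn + h *: (zn - xn)) :
  r ^+ 2 = 2 * r + 1 -> 0 <= r -> 0 <= t ->
  t ^+ 2 * dot (xn - zn) (xn - zn) + 2 * A <= dot (x0 - zn) (x0 - zn) ->
  t ^+ 2 * dot (xN - zN) (xN - zN) + 2 * B <= dot (y - zN) (y - zN) ->
  0 <= B ->
  0 <= B + (t - 1) * (f - g) - dot (y - xN) (zn - zN) ->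
  0 <= g - f - dot (xn - zn) (zN - zn) ->
  0 <= f - g - dot (xN - zN) (zn - zN) ->
  (r * t) ^+ 2 * dot (xN - zN) (xN - zN)
    + 2 * (A + (t - 1) * (g - f) - dot (x0 - xn) (zN - zn)
           + h * (g - f - dot (xn - zn) (zN - zn)) + B)
    <= dot (x0 - zN) (x0 - zN).
Proof.
move=> r2 r0 t0; rewrite -subr_ge0 => Pa; rewrite -subr_ge0 => Pb B0 C0 Q1 Q2.
rewrite -subr_ge0.
set P := (X in 0 <= X) in Pa; set P' := (X in 0 <= X) in Pb.
set C := (X in 0 <= X) in C0; set Q := (X in 0 <= X) in Q1.
set Q' := (X in 0 <= X) in Q2.
(* By [r2] the multiplier 1 + 2r of [P'] is r^2, which raises t^2 to (r t)^2. The multiples of [B]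
   and [C] bring the coefficient of [B] back to -2, and the multiple of [Q'] removes the terms
   linear in [xN] that [C] brings. *)
have -> : dot (x0 - zN) (x0 - zN) -
    ((r * t) ^+ 2 * dot (xN - zN) (xN - zN)
    + 2 * (A + (t - 1) * (g - f) - dot (x0 - xn) (zN - zn) + h * Q + B)) =
    P + (1 + 2 * r) * P' + 2 * r * B + 2 * r * C + 2 * r * Q' + 2 * t * Q.
  rewrite /P /P' /C /Q /Q' /y /h !dotE (dotC zn x0) (dotC zN x0).
  rewrite (dotC zn xn) (dotC zN xn) (dotC xN zn) (dotC zN zn).
  rewrite (dotC zN xN).
  ring: r2.
by clearbody P P' C Q Q'; rewrite !(addr_ge0, mulr_ge0).
Qed.

End Certificate.

(** * Arithmetic of the silver schedule *)

Section Silver.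
Context {R : realType}.
Local Notation rho := (rho R).
Local Notation silver := (silver R).

Lemma rho_gt0 : 0 < rho.
Proof. by rewrite ltr_pwDl ?sqrtr_ge0. Qed.

Lemma sqr_rho : rho ^+ 2 = 2 * rho + 1.
Proof.
have := @sqr_sqrtr R 2 (ler0n _ _); rewrite /Defs.rho => s2.
by rewrite sqrrD s2 expr1n; ring.
Qed.

Lemma silver_gt0 k : 0 < silver k.
Proof. by rewrite ltr_wpDr // exprz_ge0 // ltW // rho_gt0. Qed.

(** The inverse of rho is rho - 2, so the integer power rho^(m-1) becomes a natural power times a
    polynomial factor, even for m = 0. *)
Lemma silver_mid m : silver (2 ^ m).-1 = 1 + rho ^+ m * (rho - 2).
Proof.
have r0 : rho != 0 by rewrite gt_eqF ?rho_gt0.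
rewrite /Defs.silver prednK ?expn_gt0// pfactorK// expfzDr// -exprnP exprN1.
congr (1 + _ * _); apply: (mulfI r0).
by rewrite divff// mulrBr -expr2 sqr_rho; ring.
Qed.

(** For 0 < j < 2^m, the numbers j and 2^m + j have the same 2-adic valuation: 2^e divides 2^m if e
    <= m, and exceeds both numbers if e > m. *)
Lemma silver_shift m k : (k < (2 ^ m).-1)%N -> silver (2 ^ m + k) = silver k.
Proof.
move=> km; congr (1 + _ ^ (_%:Z - 1)); rewrite -addnS.
have km2 : (k.+1 < 2 ^ m)%N by lia.
have logP e : (e <= logn 2 (2 ^ m + k.+1))%N = (e <= logn 2 k.+1)%N.
  rewrite -!pfactor_dvdn ?addnS//.
  have [em|me] := leqP e m; first by rewrite -addnS dvdn_addr// dvdn_exp2l.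
  have : (2 ^ m.+1 <= 2 ^ e)%N by rewrite leq_exp2l.
  by rewrite expnS => le; rewrite !gtnNdvd//; lia.
by apply/eqP; rewrite eqn_leq logP leqnn -logP leqnn.
Qed.

(** * Gap sums and descent along silver runs *)

Section Descent.
Context {d : nat}.
Implicit Types (x z : nat -> 'rV[R]_d) (phi : nat -> R) (w : 'rV[R]_d).

Definition gap x z phi k w c := c - phi k - dot (x k - z k) (w - z k).

Definition silver_gap x z phi n w c :=
  \sum_(k < n) silver k * gap x z phi k w c.

Definition relaxed_run x z n :=
  forall k, (k < n)%N -> x k.+1 = x k + silver k *: (z k - x k).

Lemma silver_gap_ge0 x z phi n w c :
  (forall k, (k < n)%N -> 0 <= gap x z phi k w c) ->
  0 <= silver_gap x z phi n w c.
Proof.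
by move=> h; apply: sumr_ge0 => k _; rewrite mulr_ge0 ?h// ltW ?silver_gt0.
Qed.

Lemma sum_silver_step x z n : relaxed_run x z n ->
  \sum_(k < n) silver k *: (x k - z k) = x 0 - x n.
Proof.
elim: n => [_|n IH xz]; first by rewrite big_ord0 subrr.
rewrite big_ord_recr/= IH => [|k kn]; last by apply: xz; lia.
by rewrite xz// -(opprB (z n)) scalerN opprD addrA.
Qed.

(** Shaped for splitting a sum into first half, middle step and second half. *)
Lemma double_pred_expn2 m : (2 ^ m.+1).-1 = ((2 ^ m).-1 + (2 ^ m).-1.+1)%N.
Proof. by rewrite expnS; have := expn_gt0 2 m; lia. Qed.

(** Doubling gives 2 (rho^m - 1) + 1 + rho^m (rho - 2) = rho^(m+1) - 1. *)
Lemma sum_silver m : \sum_(k < (2 ^ m).-1) silver k = rho ^+ m - 1.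
Proof.
elim: m => [|m IH]; first by rewrite big_ord0 expr0 subrr.
rewrite double_pred_expn2 big_split_ord big_ord_recl /= addn0 IH silver_mid.
under eq_bigr => i _ do
  rewrite /= /bump add1n addnS -addSn prednK ?expn_gt0// silver_shift//.
by rewrite IH exprS; ring.
Qed.

Lemma silver_gap_shift x z phi m w c w' c' :
  relaxed_run x z (2 ^ m).-1 ->
  silver_gap x z phi (2 ^ m).-1 w c =
    silver_gap x z phi (2 ^ m).-1 w' c' + (rho ^+ m - 1) * (c - c')
    - dot (x 0 - x (2 ^ m).-1) (w - w').
Proof.
move=> /sum_silver_step <-; rewrite -sum_silver dot_suml mulr_suml -sumrN.
rewrite -!big_split; apply: eq_bigr => k _ /=.
rewrite /gap dotZl (_ : w - z k = (w - w') + (w' - z k)) ?dotDr ?subrKA//.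
by ring.
Qed.

Lemma silver_gap_double x z phi m w c (n := (2 ^ m).-1) :
  silver_gap x z phi (2 ^ m.+1).-1 w c =
    silver_gap x z phi n w c
    + (1 + rho ^+ m * (rho - 2)) * gap x z phi n w c
    + silver_gap (fun k => x (2 ^ m + k)%N) (fun k => z (2 ^ m + k)%N)
        (fun k => phi (2 ^ m + k)%N) n w c.
Proof.
rewrite /silver_gap double_pred_expn2 big_split_ord big_ord_recl /= addn0.
rewrite silver_mid -[RHS]addrA; congr (_ + (_ + _)); apply: eq_bigr => k _ /=.
by rewrite /bump add1n addnS -addSn prednK ?expn_gt0// silver_shift.
Qed.

(** Stated for abstract sequences with mutually nonnegative gaps, so that the induction hypothesis
    also applies to the shifted second half. For m = 0 it is an equality. *)
Lemma silver_descent m x z phi (n := (2 ^ m).-1) :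
  relaxed_run x z n ->
  (forall i j, (i <= n)%N -> (j <= n)%N -> 0 <= gap x z phi j (z i) (phi i)) ->
  (rho ^+ m) ^+ 2 * dot (x n - z n) (x n - z n)
    + 2 * silver_gap x z phi n (z n) (phi n)
    <= dot (x 0 - z n) (x 0 - z n).
Proof.
elim: m x z phi @n => [|m IH] x z phi n xz Q.
  by rewrite /silver_gap big_ord0 mulr0 addr0 expr0 expr1n mul1r.
have N0 : (0 < 2 ^ m)%N by rewrite expn_gt0.
have nE : n = ((2 ^ m).-1 + (2 ^ m).-1.+1)%N by rewrite /n double_pred_expn2.
set k := (2 ^ m).-1 in nE; have kE : (2 ^ m = k.+1)%N by rewrite prednK.
(* The second half starts just after the middle step, which has index [k]. *)
pose y i := x (2 ^ m + i)%N; pose v i := z (2 ^ m + i)%N.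
pose psi i := phi (2 ^ m + i)%N.
have nS : n = (2 ^ m + k)%N by lia.
have xz1 : relaxed_run x z k by move=> i ik; apply: xz; lia.
have xz2 : relaxed_run y v k.
  by move=> i ik; rewrite /y addnS xz ?silver_shift//; lia.
have := IH _ _ psi xz2; have := IH _ _ phi xz1; rewrite -/k.
move=> /(_ _)/wrap[|Pa]; first by move=> i j ik jk; apply: Q; lia.
move=> /(_ _)/wrap[|Pb]; first by move=> i j ik jk; apply: Q; lia.
move: Pa Pb; rewrite {4}/n silver_gap_double -/k -/y -/v -/psi.
(* The first-half sum is moved to the reference point at which the induction hypothesis bounds
   it. *)
rewrite (silver_gap_shift _ _ phi _ (z n) (phi n) (z k) (phi k) xz1).
have Sn : 0 <= silver_gap y v psi k (z n) (phi n).
  by apply: silver_gap_ge0 => i ik; apply: Q; lia.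
(* Measuring the second half at the last point of the first half couples the two halves. *)
have : 0 <= silver_gap y v psi k (z k) (phi k).
  by apply: silver_gap_ge0 => i ik; apply: Q; lia.
rewrite (silver_gap_shift _ _ psi _ (z k) (phi k) (z n) (phi n) xz2) -/k.
have := Q k n ltac:(lia) ltac:(lia); have := Q n k ltac:(lia) ltac:(lia).
have -> : v k = z n by rewrite /v nS.
have -> : psi k = phi n by rewrite /psi nS.
have -> : y k = x n by rewrite /y nS.
have -> : y 0%N = x k + silver k *: (z k - x k).
  by rewrite /y addn0 kE xz//; lia.
rewrite silver_mid (exprS rho) => Qkn Qnk Ck Pa Pb.
apply: (descent_glue rho (rho ^+ m) (silver_gap x z phi k (z k) (phi k))
  (silver_gap y v psi k (z n) (phi n)) _ _ _ _ _ _ _ sqr_rho) => //.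
- exact/ltW/rho_gt0.
- exact/exprn_ge0/ltW/rho_gt0.
Qed.

Lemma silver_rate m x z phi w c (n := (2 ^ m).-1) :
  relaxed_run x z n ->
  (forall i j, (i <= n)%N -> (j <= n)%N -> 0 <= gap x z phi j (z i) (phi i)) ->
  (forall j, (j <= n)%N -> 0 <= gap x z phi j w c) ->
  4 * rho ^+ m * (phi n - c) <= dot (x 0 - w) (x 0 - w).
Proof.
move=> xz Q Qw.
have := silver_descent m x z phi xz Q; rewrite -/n.
have := silver_gap_ge0 x z phi n w c (fun k kn => Qw k (ltnW kn)).
rewrite (silver_gap_shift _ _ phi _ w c (z n) (phi n) xz) -/n.
have := Qw n (leqnn n); rewrite /gap.
(* This is the square left over in the final identity. *)
have := dot_ge0 (x n - w - (rho ^+ m + 1) *: (x n - z n)).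
have : 0 <= rho ^+ m by exact/exprn_ge0/ltW/rho_gt0.
move: (x 0) (x n) (z n) (phi n) (rho ^+ m) (silver_gap _ _ _ _ _ _).
move=> x0 xn zn f t A t0 sq0 Qn Sw P; rewrite -subr_ge0.
set S := (X in 0 <= X) in sq0; set Qs := (X in 0 <= X) in Qn.
set T := (X in 0 <= X) in Sw; rewrite -subr_ge0 in P.
set P' := (X in 0 <= X) in P.
(* The weights make [A] cancel between [P'] and [T], and give c - f the coefficient 2 (t - 1) + 2 (t
   + 1) = 4 t. *)
have -> : dot (x0 - w) (x0 - w) - 4 * t * (f - c) =
    P' + 2 * T + 2 * (t + 1) * Qs + S.
  rewrite /P' /T /Qs /S !dotE (dotC zn x0) (dotC w x0).
  rewrite (dotC zn xn) (dotC w xn) (dotC w zn).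
  ring.
by clearbody P' T Qs S; rewrite !(addr_ge0, mulr_ge0).
Qed.

End Descent.
End Silver.

(** * Existence of the proximal point and its subgradient inequality *)

Section Prox.
Context {R : realType} {d : nat}.
Context (lam : R) (F : 'rV[R]_d -> \bar R).
Context (lam0 : 0 < lam) (Fproper : proper_fun F) (Fclosed : closed_fun F).
Context (Fconvex : convex_fun F).

Lemma argmin_fin_num xs : argmin F xs -> F xs \is a fin_num.
Proof.
move=> Fmin; have [Foo [y Fy]] := Fproper.
by rewrite fin_numE Foo lt_eqF// (le_lt_trans (Fmin y)).
Qed.

(** Minimizing the continuous function t + q(z) over a compact piece of the closed epigraph replaces
    a lower semicontinuity argument for F. *)
Lemma argmin_prox_set (x : 'rV[R]_d) : argmin F !=set0 ->
  argmin (fun z => F z + (1 / (2 * lam) * enorm (z - x) ^+ 2)%:E)%E !=set0.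
Proof.
move=> [xs Fmin]; have /fineK := argmin_fin_num _ Fmin.
set c := fine _ => cE; have Fc z : (c%:E <= F z)%E by rewrite cE.
pose q (z : 'rV[R]_d) := 1 / (2 * lam) * enorm (z - x) ^+ 2.
have q0 z : 0 <= q z by rewrite mulr_ge0 ?sqr_ge0// divr_ge0// mulr_ge0// ltW.
pose M := enorm (xs - x).
pose B := [set v : 'rV[R]_d |
  forall i, `[x ord0 i - M, x ord0 i + M]%classic (v ord0 i)].
pose K := B `*` `[c, c + q xs].
pose E := [set p : 'rV[R]_d * R | (F p.1 <= p.2%:E)%E] `&` K.
have cptK : compact K.
  apply: compact_setX; last exact: segment_compact.
  apply: (@rV_compact R d (fun i => `[x ord0 i - M, x ord0 i + M]%classic)).
  by move=> i; exact: segment_compact.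
have cptE : compact E by rewrite /E setIC; exact: compact_closedI.
have boxP z : q z <= q xs -> B z.
  rewrite /q ler_pM2l ?divr_gt0 ?mulr_gt0// => zM i.
  rewrite /= in_itv/= -ler_distl -ler_sqr ?nnegrE ?sqrtr_ge0//.
  rewrite real_normK ?num_real//.
  apply: le_trans zM; rewrite sqr_enorm /dot (bigD1 i)//= !mxE -expr2 lerDl.
  by apply: sumr_ge0 => j _; rewrite -expr2 sqr_ge0.
have Exs : E (xs, c).
  split; first by rewrite /= cE.
  by split => /=; [exact: boxP|rewrite in_itv/= lexx lerDl q0].
have cont : continuous (fun p : 'rV[R]_d * R => p.2 + q p.1).
  move=> p; apply: cvgD; first exact: cvg_snd.
  under eq_fun => r do rewrite /q sqr_enorm /dot.
  apply: cvgM; first exact: cvg_cst.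
  rewrite sqr_enorm; apply: cvg_big => // [|i _]; first exact: add_continuous.
  have fi : (fun r : 'rV[R]_d * R => (r.1 - x) ord0 i) r @[r --> p] -->
      (p.1 - x) ord0 i.
    under eq_fun => r do rewrite !mxE.
    rewrite !mxE; apply: cvgB; last exact: cvg_cst.
    apply: (@continuous_comp _ _ _ fst (fun v : 'rV[R]_d => v ord0 i)).
      exact: cvg_fst.
    exact: coord_continuous.
  exact: cvgM.
have [] := @compact_EVT_min _ _ (fun p : 'rV[R]_d * R => p.2 + q p.1) E _ cptE.
- by exists (xs, c).
- exact: continuous_subspaceT.
move=> [z t] /set_mem[/= Fzt _] minE; exists z => y.
(* A point worse than [xs] loses to (xs, c), which lies in [E]; for any other [y], the lower bound
   [c] on F puts (y, F y) in [E]. *)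
have [Fy|Fy] := leP (F y + (q y)%:E)%E (c + q xs)%:E; last first.
  apply: le_trans (ltW Fy); rewrite (le_trans (leeD2r _ Fzt))//.
  by rewrite -EFinD lee_fin; have := minE _ (mem_set Exs).
have yc := Fc y.
have Fyfin : F y \is a fin_num by move: Fy yc; case: (F y).
move: Fy yc; rewrite -(fineK Fyfin) -EFinD !lee_fin => Fy yc.
apply: le_trans (leeD2r _ Fzt) _; rewrite -EFinD lee_fin.
apply: (minE (y, fine (F y))); rewrite inE; split; first by rewrite /= fineK.
split => /=; first by apply: boxP; have := q0 y; lra.
by rewrite in_itv/= yc/=; have := q0 y; lra.
Qed.

(** Compare the proximal point z with t y + (1 - t) z, use convexity, divide by t and let t tend to
    0. *)
Lemma prox_subgradient x y : argmin F !=set0 ->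
  (F (prox lam F x) + (dot (x - prox lam F x) (y - prox lam F x) / lam)%:E
    <= F y)%E.
Proof.
move=> Fmin; have [xs /argmin_fin_num xsfin] := Fmin.
(* Existence rules out the default value of [get]. *)
have := getPex (argmin_prox_set x Fmin); rewrite -/(prox lam F x).
move: (prox _ _ _) => z zmin.
have [Foo _] := Fproper.
have zfin : F z \is a fin_num.
  have := zmin xs; rewrite fin_numE Foo /=.
  by case: (F z) => //; rewrite -(fineK xsfin).
have [->|yoo] := eqVneq (F y) +oo%E; first exact: leey.
have yfin : F y \is a fin_num by rewrite fin_numE Foo.
rewrite -(fineK zfin) -(fineK yfin) -EFinD lee_fin.
set a := fine (F z); set b := fine (F y).
pose c := 1 / (2 * lam); have c0 : 0 < c by rewrite divr_gt0 ?mulr_gt0.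
have D0 := mulr_ge0 (ltW c0) (dot_ge0 (y - z)).
suff : a - b <= 2 * c * dot (z - x) (y - z).
  have -> : 2 * c = lam^-1 by rewrite /c; field; rewrite gt_eqF.
  by rewrite -(opprB z x) dotNl mulNr mulrC; lra.
apply/ler_addgt0Pr => e e0.
(* An explicit t in (0, 1] that makes the quadratic remainder t c |y - z|^2 at most e. *)
pose t := e / (c * dot (y - z) (y - z) + e).
have den0 : 0 < c * dot (y - z) (y - z) + e by rewrite ltr_wpDl.
have t0 : 0 < t by rewrite divr_gt0.
have t1 : t <= 1 by rewrite ler_pdivrMr// mul1r lerDr.
have te : t * (c * dot (y - z) (y - z)) <= e.
  by rewrite /t mulrAC ler_pdivrMr// ler_pM2l// lerDl ltW.
have := le_trans (zmin _) (leeD2r _ (Fconvex y z t (ltW t0) t1)).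
rewrite -(fineK zfin) -(fineK yfin) -/a -/b -!EFinM -!EFinD lee_fin !sqr_enorm.
rewrite (_ : t *: y + (1 - t) *: z - x = (z - x) + t *: (y - z)); last first.
  by apply/rowP => i; rewrite !mxE; ring.
rewrite -/c (dotDl (z - x)) !(dotDr _ (z - x)) !dotZl !dotZr.
rewrite (dotC (y - z) (z - x)) => H; rewrite -(ler_pM2l t0).
have : t * (t * (c * dot (y - z) (y - z))) <= t * e by rewrite ler_pM2l.
by move: H; lra.
Qed.

Lemma prox_fin_num x : argmin F !=set0 -> F (prox lam F x) \is a fin_num.
Proof.
move=> Fmin; have [xs /argmin_fin_num xsfin] := Fmin.
have := prox_subgradient x xs Fmin; rewrite fin_numE (proj1 Fproper)/=.
by case: (F (prox _ _ _)) => //; rewrite -(fineK xsfin).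
Qed.

(** The subgradient inequality times [lam], in the form of an unfolded [gap] with phi = lam F. *)
Lemma prox_ineq x y : argmin F !=set0 -> F y \is a fin_num ->
  0 <= lam * fine (F y) - lam * fine (F (prox lam F x))
       - dot (x - prox lam F x) (y - prox lam F x).
Proof.
move=> Fmin Fy; have := prox_subgradient x y Fmin.
rewrite -(fineK (prox_fin_num x Fmin)) -(fineK Fy) -EFinD lee_fin.
by rewrite -(ler_pM2l lam0) mulrDr mulrCA divff ?gt_eqF// mulr1; lra.
Qed.

End Prox.

Theorem theorem4 (R : realType) (d m N : nat) (hm : (1 <= m)%N)
    (hN : N = (2 ^ m - 1)%N) (lam : R) (hlam : 0 < lam)
    (F : 'rV[R]_d -> \bar R)
    (hproper : proper_fun F) (hclosed : closed_fun F) (hconvex : convex_fun F)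
    (hmin : argmin F !=set0)
    (x z : nat -> 'rV[R]_d)
    (hz : forall k : nat, (k < N)%N -> z k = prox lam F (x k))
    (hx : forall k : nat, (k < N)%N ->
            x k.+1 = x k + silver R k *: (z k - x k))
    (hzN : z N = prox lam F (x N))
    (xs : 'rV[R]_d) (hxs : argmin F xs) :
  (F (z N) - F xs
     <= (enorm (x 0%N - xs) ^+ 2 / (4 * lam * rho R ^+ m))%:E)%E.
Proof.
have zE k : (k <= N)%N -> z k = prox lam F (x k).
  by rewrite leq_eqVlt => /predU1P[->|] //; exact: hz.
have zfin k : (k <= N)%N -> F (z k) \is a fin_num.
  by move=> kN; rewrite zE// prox_fin_num.
have xsfin : F xs \is a fin_num by exact: argmin_fin_num.
rewrite subn1 in hN; rewrite {}hN in hz hx hzN zE zfin *.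
pose phi k := lam * fine (F (z k)).
have H : 4 * rho R ^+ m * (phi (2 ^ m).-1 - lam * fine (F xs))
    <= dot (x 0%N - xs) (x 0%N - xs).
  apply: (silver_rate _ _ z) => // [i j iN jN|j jN].
    by rewrite /gap /phi (zE j jN); apply: prox_ineq => //; exact: zfin.
  by rewrite /gap /phi (zE j jN); exact: prox_ineq.
have r0 : 0 < rho R ^+ m by rewrite exprn_gt0// rho_gt0.
rewrite -(fineK (zfin _ (leqnn _))) -(fineK xsfin) -EFinB lee_fin sqr_enorm.
rewrite ler_pdivlMr ?mulr_gt0//; apply: le_trans H.
by rewrite le_eqVlt /phi; apply/predU1P; left; ring.
Qed.
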